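(* Let $\bm Z$ be the Gram matrix of an equiangular tight frame of $28$ vectors in $\mathbb{R}^7$, and let $N\ge 28$. Then for every $\bm X \in \mathscr{E}_4^N$ and every injective map $\pi:[28]\to[N]$, $$\sum_{1\le i<j\le 28} \mathrm{sgn}(Z_{ij})\, X_{\pi(i)\pi(j)} \le 112.$$ Moreover, this inequality cannot be obtained as a nonnegative linear combination of the triangle inequalities $-s_is_jX_{ij} - s_js_kX_{jk} - s_is_kX_{ik} \le 1$ ($i,j,k$ distinct, $\bm s\in\{\pm1\}^N$).
   Context: Unit vectors $\bm v_1,\dots,\bm v_N\in\mathbb{R}^r$ form an equiangular tight frame (ETF) if $\sum_i \bm v_i\bm v_i^\top = \frac{N}{r}\bm I_r$ and there is $\alpha\in[0,1]$ with $|\langle\bm v_i,\bm v_j\rangle| = \alpha$ for all $i\neq j$. A degree 4 pseudomoment matrix is a matrix $\bm Y \in \mathbb{R}^{N^2\times N^2}$, rows and columns indexed by pairs $(ij)\in[N]^2$ (lexicographically ordered), such that: (1) $\bm Y\succeq 0$; (2) $Y_{(ij)(kk)}$ does not depend on $k$; (3) $Y_{(ii)(ii)} = 1$ for all $i$; (4) $Y_{(ij)(k\ell)}$ is invariant under all permutations of the four indices $i,j,k,\ell$. Such $\bm Y$ extends $\bm X\in\mathbb{R}^{N\times N}_{\mathrm{sym}}$ if $Y_{(1i)(1j)} = X_{ij}$ for all $i,j$. $\mathscr{E}_4^N$ is the set of symmetric $\bm X \in \mathbb{R}^{N\times N}$ that are extended by some degree 4 pseudomoment matrix. *)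

(* Defs.v *)
(* Reals are modelled by an arbitrary real closed field R. *)
From HB Require Import structures.
From mathcomp Require Import all_boot all_order all_algebra all_fingroup.
Set Implicit Arguments. Unset Strict Implicit. Unset Printing Implicit Defensive.
Import Order.TTheory GRing.Theory Num.Theory.
Local Open Scope ring_scope.

Section Defs.
Variable R : rcfType.

Definition dotv (r : nat) (u w : 'cV[R]_r) : R := (u^T *m w) ord0 ord0.

Definition is_ETF (n r : nat) (v : 'I_n -> 'cV[R]_r) : Prop :=
  (forall i, dotv (v i) (v i) = 1) /\
  (\sum_(i < n) v i *m (v i)^T = (n%:R / r%:R) *: 1%:M) /\
  (exists alpha : R, 0 <= alpha <= 1 /\
     forall i j : 'I_n, i != j -> `|dotv (v i) (v j)| = alpha).

Definition gram (n r : nat) (v : 'I_n -> 'cV[R]_r) : 'M[R]_n :=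
  \matrix_(i, j) dotv (v i) (v j).

Definition psd (m : nat) (A : 'M[R]_m) : Prop :=
  forall x : 'cV[R]_m, 0 <= (x^T *m A *m x) ord0 ord0.

(* entry Y_{(ij)(kl)} of an N^2 x N^2 matrix whose rows/columns are indexed
   by pairs in lexicographic order (mxvec_index is the lexicographic rank) *)
Definition Yent (N : nat) (Y : 'M[R]_(N * N)) (i j k l : 'I_N) : R :=
  Y (mxvec_index i j) (mxvec_index k l).

Definition is_pseudomoment4 (N : nat) (Y : 'M[R]_(N * N)) : Prop :=
  psd Y /\
  (forall i j k k' : 'I_N, Yent Y i j k k = Yent Y i j k' k') /\
  (forall i : 'I_N, Yent Y i i i i = 1) /\
  (forall (f : 'I_4 -> 'I_N) (s : {perm 'I_4}),
      Yent Y (f (s 0%R)) (f (s 1%R)) (f (s 2%R)) (f (s 3%R))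
      = Yent Y (f 0%R) (f 1%R) (f 2%R) (f 3%R)).

(* Y extends X : Y_{(1i)(1j)} = X_ij, where "1" is the first index of [N] *)
Definition extends (N : nat) (Y : 'M[R]_(N * N)) (X : 'M[R]_N) : Prop :=
  forall i1 : 'I_N, nat_of_ord i1 = 0%N ->
    forall i j : 'I_N, Yent Y i1 i i1 j = X i j.

Definition in_E4 (N : nat) (X : 'M[R]_N) : Prop :=
  X^T = X /\ exists Y : 'M[R]_(N * N), is_pseudomoment4 Y /\ extends Y X.

Definition sgnb (b : bool) : R := if b then 1 else -1.

Definition tri_lhs (N : nat) (s : {ffun 'I_N -> bool}) (i j k : 'I_N)
  (X : 'M[R]_N) : R :=
  - (sgnb (s i) * sgnb (s j) * X i j) - sgnb (s j) * sgnb (s k) * X j k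
  - sgnb (s i) * sgnb (s k) * X i k.

Definition distinct3 (N : nat) (i j k : 'I_N) : bool :=
  [&& i != j, j != k & i != k].

Definition triangle_derivable (N : nat) (c : 'M[R]_N -> R) (b : R) : Prop :=
  exists lam : 'I_N -> 'I_N -> 'I_N -> {ffun 'I_N -> bool} -> R,
    (forall i j k s, 0 <= lam i j k s) /\
    (forall X : 'M[R]_N, X^T = X ->
       \sum_(i < N) \sum_(j < N) \sum_(k < N | distinct3 i j k)
          \sum_(s : {ffun 'I_N -> bool}) lam i j k s * tri_lhs s i j k X
       = c X) /\
    \sum_(i < N) \sum_(j < N) \sum_(k < N | distinct3 i j k)
          \sum_(s : {ffun 'I_N -> bool}) lam i j k s <= b.

Definition etf_form (n N : nat) (Z : 'M[R]_n) (pi : 'I_n -> 'I_N)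
  (X : 'M[R]_N) : R :=
  \sum_(i < n) \sum_(j < n | (i < j)%N) Num.sg (Z i j) * X (pi i) (pi j).

End Defs.

(* Main.v *)
Require Import Defs.
From HB Require Import structures.
From mathcomp Require Import all_boot all_order all_algebra all_fingroup.
From mathcomp Require Import ring lra.
Import Order.TTheory GRing.Theory Num.Theory.
Local Open Scope ring_scope.

(* Let Z be the Gram matrix, so Z^2 = 4 Z and Z_ij = +-1/3 off the diagonal.
   Write E for the pseudo-expectation, u_i = (Z x)_i, s_i = 4 x_i - u_i and
   W = x^T Z x = sum_i x_i u_i = (1/4) sum_i u_i^2.  Since 28 = dim Sym^2(R^7),
   the frame is a 4-design: the tensor sum_i v_i^(x)4 is (4/3) Sym(I (x) I),
   because the difference has norm 0; hence sum_i E u_i^4 = (4/3) E W^2.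
   On the other hand |E s_i^2 x_j x_k| <= E s_i^2 and sum_j |Z_ij| = 10 give
   E s_i^2 x_i u_i <= 10 E s_i^2 and E s_i^2 u_i^2 <= 100 E s_i^2, which combine
   to an upper bound on E u_i^4 affine in E x_i u_i and E u_i^2.  Summing over i,
   (4/3) E W^2 <= 80640 - 656 E W, and E (W - 100)^2 >= 0 then bounds E W, which
   is 28 plus 2/3 of the form.  The triangle inequalities all hold when
   X = sgn(Z) / 3, where the form is 126. *)

(** * Fourfold sums and reordering of their indices *)

Section Sum4.
Context {R : comNzRingType} {n : nat}.
Implicit Types F G : 'I_n -> 'I_n -> 'I_n -> 'I_n -> R.

Definition sum4 F : R := \sum_a \sum_b \sum_c \sum_d F a b c d.

Lemma eq_sum4 F G :
  (forall a b c d, F a b c d = G a b c d) -> sum4 F = sum4 G.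
Proof.
by move=> FG; do 4![apply: eq_bigr => ? _]; apply: FG.
Qed.

Lemma sum4D F G :
  sum4 (fun a b c d => F a b c d + G a b c d) = sum4 F + sum4 G.
Proof.
by rewrite /sum4; do 4![rewrite -big_split; apply: eq_bigr => ? _ /=].
Qed.

Lemma sum4Z x F : sum4 (fun a b c d => x * F a b c d) = x * sum4 F.
Proof. by rewrite /sum4; do 4![rewrite mulr_sumr; apply: eq_bigr => ? _]. Qed.

Lemma sum4C12 F : sum4 F = sum4 (fun a b c d => F b a c d).
Proof. exact: exchange_big. Qed.

Lemma sum4C23 F : sum4 F = sum4 (fun a b c d => F a c b d).
Proof. by apply: eq_bigr => a _; apply: exchange_big. Qed.

Lemma sum4C34 F : sum4 F = sum4 (fun a b c d => F a b d c).
Proof. by do 2![apply: eq_bigr => ? _]; apply: exchange_big. Qed.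

Lemma sum4_sum (I : finType) (F : I -> 'I_n -> 'I_n -> 'I_n -> 'I_n -> R) :
  sum4 (fun a b c d => \sum_i F i a b c d) = \sum_i sum4 (F i).
Proof.
rewrite /sum4 [RHS]exchange_big; apply: eq_bigr => a _ /=.
rewrite [RHS]exchange_big; apply: eq_bigr => b _ /=.
rewrite [RHS]exchange_big; apply: eq_bigr => c _ /=.
exact: exchange_big.
Qed.

Lemma sum4_mul2 (f g : 'I_n -> 'I_n -> R) :
  sum4 (fun a b c d => f a b * g c d) =
  (\sum_a \sum_b f a b) * (\sum_a \sum_b g a b).
Proof.
rewrite mulr_suml; apply: eq_bigr => a _.
rewrite mulr_suml; apply: eq_bigr => b _.
rewrite mulr_sumr; apply: eq_bigr => c _.
by rewrite mulr_sumr.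
Qed.

End Sum4.

(** * Contractions of a symmetric matrix with Z^2 = k Z *)

Section TightGram.
Context {R : comNzRingType} {n : nat}.
Variables (Z : 'M[R]_n) (k : R).
Hypothesis (Zsym : Z^T = Z) (Zsqr : Z *m Z = k *: Z).

Let ZC i j : Z i j = Z j i.
Proof. by rewrite -{1}Zsym mxE. Qed.

Lemma tight_gram_row2 i j : \sum_a Z i a * Z j a = k * Z i j.
Proof.
have /matrixP/(_ i j) := Zsqr; rewrite !mxE => <-.
by apply: eq_bigr => a _; rewrite (ZC a j).
Qed.

Lemma tight_gram_row3 i j :
  \sum_a \sum_b Z i a * Z j b * Z a b = k ^+ 2 * Z i j.
Proof.
transitivity (\sum_a Z i a * (k * Z j a)).
  apply: eq_bigr => a _; rewrite -tight_gram_row2 mulr_sumr.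
  by apply: eq_bigr => b _; ring.
under eq_bigr => a _ do rewrite mulrCA.
by rewrite -mulr_sumr tight_gram_row2; ring.
Qed.

(** Expanding the square gives a double sum over i and j in which each of the four indices a, b, c,
    d contributes a factor (Z^2)_ij = k Z_ij. *)
Lemma tight_gram_fourth_moment_sqr :
  sum4 (fun a b c d => (\sum_i Z i a * Z i b * Z i c * Z i d) ^+ 2) =
  k ^+ 4 * \sum_i \sum_j Z i j ^+ 4.
Proof.
under eq_sum4 => a b c d do rewrite expr2 mulr_suml.
rewrite sum4_sum mulr_sumr; apply: eq_bigr => i _.
under eq_sum4 => a b c d do rewrite mulr_sumr.
rewrite sum4_sum mulr_sumr; apply: eq_bigr => j _.
have pairE : \sum_a \sum_b (Z i a * Z j a) * (Z i b * Z j b) =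
    (k * Z i j) ^+ 2.
  under eq_bigr => a _ do rewrite -mulr_sumr.
  by rewrite -mulr_suml tight_gram_row2 expr2.
rewrite (_ : k ^+ 4 * _ = (k * Z i j) ^+ 2 * (k * Z i j) ^+ 2); last by ring.
rewrite -pairE -sum4_mul2; apply: eq_sum4 => a b c d; ring.
Qed.

(** For fixed i the sum factors into two copies of (Z^3)_ii = k^2 Z_ii. *)
Lemma tight_gram_fourth_moment_pair :
  sum4 (fun a b c d =>
    (\sum_i Z i a * Z i b * Z i c * Z i d) * (Z a b * Z c d)) =
  k ^+ 4 * \sum_i Z i i ^+ 2.
Proof.
under eq_sum4 => a b c d do rewrite mulr_suml.
rewrite sum4_sum mulr_sumr; apply: eq_bigr => i _.
rewrite (_ : k ^+ 4 * _ = (\sum_a \sum_b Z i a * Z i b * Z a b)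
  * (\sum_a \sum_b Z i a * Z i b * Z a b)).
  by rewrite -sum4_mul2; apply: eq_sum4 => a b c d; ring.
by rewrite tight_gram_row3; ring.
Qed.

Lemma tight_gram_pair_sqr :
  sum4 (fun a b c d => (Z a b * Z c d) ^+ 2) = k ^+ 2 * (\sum_i Z i i) ^+ 2.
Proof.
have sqrE : \sum_a \sum_b Z a b * Z a b = k * \sum_i Z i i.
  by rewrite mulr_sumr; apply: eq_bigr => a _; apply: tight_gram_row2.
rewrite -exprMn expr2 -sqrE -sum4_mul2.
by apply: eq_sum4 => a b c d; ring.
Qed.

(** The indices form the cycle a, b, d, c, so the sum is tr Z^4 = k^3 tr Z. *)
Lemma tight_gram_pair_cross :
  sum4 (fun a b c d => (Z a b * Z c d) * (Z a c * Z b d)) =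
  k ^+ 3 * \sum_i Z i i.
Proof.
rewrite mulr_sumr; apply: eq_bigr => a _.
transitivity (\sum_b k ^+ 2 * (Z a b * Z a b)).
  apply: eq_bigr => b _; transitivity (Z a b * (k ^+ 2 * Z a b)); last by ring.
  rewrite -tight_gram_row3 mulr_sumr; apply: eq_bigr => c _.
  by rewrite mulr_sumr; apply: eq_bigr => d _; ring.
by rewrite -mulr_sumr tight_gram_row2; ring.
Qed.

End TightGram.

(** * Gram matrices of equiangular tight frames *)

Section EquiangularGram.
Context {R : rcfType}.

Lemma gramC n r (v : 'I_n -> 'cV[R]_r) : (gram v)^T = gram v.
Proof.
apply/matrixP => i j; rewrite !mxE /dotv !mxE.
by apply: eq_bigr => a _; rewrite !mxE mulrC.
Qed.

(** If V has columns v_i, then Z = V^T V and Z^2 = V^T (V V^T) V, where tightness makes V V^T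
    scalar. *)
Lemma ETF_gram_sqr n r (v : 'I_n -> 'cV[R]_r) : is_ETF v ->
  gram v *m gram v = (n%:R / r%:R) *: gram v.
Proof.
case=> _ [tight _]; apply/matrixP => i j; rewrite !mxE.
transitivity (((v i)^T *m (\sum_k v k *m (v k)^T) *m v j) ord0 ord0).
  rewrite mulmx_sumr mulmx_suml summxE; apply: eq_bigr => k _.
  by rewrite ![gram v _ _]mxE /dotv mulmxA -mulmxA [RHS]mxE big_ord1.
by rewrite tight -scalemxAr mulmx1 -scalemxAl mxE.
Qed.

Lemma ETF_gram_diag n r (v : 'I_n -> 'cV[R]_r) i :
  is_ETF v -> gram v i i = 1.
Proof. by case=> norm1 _; rewrite mxE. Qed.

(** A diagonal entry of Z^2 = 4 Z reads 1 + 27 alpha^2 = 4, and alpha >= 0 selects the root 1/3. *)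
Lemma ETF28_7_gram_norm (v : 'I_28 -> 'cV[R]_7) i j :
  is_ETF v -> i != j -> `|gram v i j| = 3%:R^-1.
Proof.
move=> etf; set Z := gram v.
have [_ [_ [al [/andP[al0 _] alE]]]] := etf.
have ZE a b : a != b -> `|Z a b| = al by move=> ab; rewrite mxE alE.
move=> /ZE ->.
have := tight_gram_row2 Z _ (gramC _ _ v) (ETF_gram_sqr _ _ v etf) i i.
rewrite (bigD1 i) //= (eq_bigr (fun=> al ^+ 2)); last first.
  by move=> a; rewrite eq_sym => /ZE <-; rewrite -normrX ger0_norm ?sqr_ge0 // expr2.
rewrite sumr_const cardC1 card_ord ETF_gram_diag //= -mulr_natl => e.
have alsq : (al - 3^-1) * (al + 3^-1) = 0 by rewrite -subr_sqr; lra.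
have alp : al + 3^-1 != 0 by rewrite gt_eqF //; lra.
by move/eqP: alsq; rewrite mulf_eq0 (negPf alp) orbF subr_eq0 => /eqP.
Qed.

End EquiangularGram.

(** * The 4-design identity for 28 vectors in dimension 7 *)

Section EtfFourthMoment.
Context {R : rcfType}.
Variable v : 'I_28 -> 'cV[R]_7.
Hypothesis etf : is_ETF v.
Let Z := gram v.

Let Zsym : Z^T = Z. Proof. exact: gramC. Qed.
Let ZC i j : Z i j = Z j i. Proof. by rewrite -{1}Zsym mxE. Qed.
Let Zsqr : Z *m Z = 4%:R *: Z.
Proof. by rewrite ETF_gram_sqr //; congr (_ *: _); lra. Qed.
Let Zdiag i : Z i i = 1. Proof. exact: ETF_gram_diag. Qed.

Let trZ : \sum_i Z i i = 28%:R.
Proof. by under eq_bigr do rewrite Zdiag; rewrite sumr_const card_ord. Qed.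

Let sumZ4 : \sum_i \sum_j Z i j ^+ 4 = 112%:R / 3%:R.
Proof.
(* Each row contributes 1 + 27 / 3^4 = 4/3. *)
transitivity (\sum_(i < 28) (4%:R / 3%:R : R)); last first.
  by rewrite sumr_const card_ord; lra.
apply: eq_bigr => i _; rewrite (bigD1 i) //= Zdiag.
rewrite (eq_bigr (fun=> 3%:R^-1 ^+ 4)); last first.
  move=> j; rewrite eq_sym => ij; rewrite -(ETF28_7_gram_norm v i j) //.
  by rewrite -normrX ger0_norm // (exprM _ 2 2) sqr_ge0.
by rewrite sumr_const cardC1 card_ord /= -mulr_natl; lra.
Qed.

(** This is the tensor identity evaluated at v_a, v_b, v_c, v_d. The factor 4/9 is 4/3 divided among
    the three pairings of the indices. *)
Lemma ETF_fourth_moment a b c d :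
  \sum_i Z i a * Z i b * Z i c * Z i d =
  4%:R / 9%:R * (Z a b * Z c d + Z a c * Z b d + Z a d * Z b c).
Proof.
pose D a b c d := \sum_i Z i a * Z i b * Z i c * Z i d.
pose g1 a b c d := Z a b * Z c d.
pose g2 a b c d := Z a c * Z b d.
pose g3 a b c d := Z a d * Z b c.
pose T a b c d :=
  D a b c d - 4%:R / 9%:R * (g1 a b c d + g2 a b c d + g3 a b c d).
have DC12 x y z w : D x y z w = D y x z w by apply: eq_bigr => i _; ring.
have DC23 x y z w : D x y z w = D x z y w by apply: eq_bigr => i _; ring.
have DC34 x y z w : D x y z w = D x y w z by apply: eq_bigr => i _; ring.
have sD : sum4 (fun a b c d => D a b c d ^+ 2) = 4%:R ^+ 4 * (112%:R / 3%:R).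
  by rewrite -sumZ4; apply: tight_gram_fourth_moment_sqr.
have sDg1 : sum4 (fun a b c d => D a b c d * g1 a b c d) = 4%:R ^+ 4 * 28%:R.
  rewrite (tight_gram_fourth_moment_pair Z 4%:R) //; congr (_ * _).
  by under eq_bigr do rewrite Zdiag expr1n; rewrite sumr_const card_ord.
have sDg2 : sum4 (fun a b c d => D a b c d * g2 a b c d) = 4%:R ^+ 4 * 28%:R.
  by rewrite -sDg1 sum4C23; apply: eq_sum4 => x y z w; rewrite DC23.
have sDg3 : sum4 (fun a b c d => D a b c d * g3 a b c d) = 4%:R ^+ 4 * 28%:R.
  rewrite -sDg2 sum4C34; apply: eq_sum4 => x y z w.
  by rewrite DC34.
have sg1 : sum4 (fun a b c d => g1 a b c d ^+ 2) = 4%:R ^+ 2 * 28%:R ^+ 2.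
  by rewrite (tight_gram_pair_sqr Z 4%:R) // trZ.
have sg2 : sum4 (fun a b c d => g2 a b c d ^+ 2) = 4%:R ^+ 2 * 28%:R ^+ 2.
  by rewrite -sg1 sum4C23.
have sg3 : sum4 (fun a b c d => g3 a b c d ^+ 2) = 4%:R ^+ 2 * 28%:R ^+ 2.
  by rewrite -sg2 sum4C34.
have s12 : sum4 (fun a b c d => g1 a b c d * g2 a b c d) = 4%:R ^+ 3 * 28%:R.
  by rewrite (tight_gram_pair_cross Z 4%:R) // trZ.
have s13 : sum4 (fun a b c d => g1 a b c d * g3 a b c d) = 4%:R ^+ 3 * 28%:R.
  rewrite -s12 sum4C34; apply: eq_sum4 => x y z w.
  by rewrite /g1 /g2 /g3 (ZC w z).
have s23 : sum4 (fun a b c d => g2 a b c d * g3 a b c d) = 4%:R ^+ 3 * 28%:R.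
  rewrite -s13 sum4C23; apply: eq_sum4 => x y z w.
  by rewrite /g1 /g2 /g3 (ZC z y).
have TE x y z w : T x y z w ^+ 2 = D x y z w ^+ 2 +
    ((- 8%:R / 9%:R) * (D x y z w * g1 x y z w) +
    ((- 8%:R / 9%:R) * (D x y z w * g2 x y z w) +
    ((- 8%:R / 9%:R) * (D x y z w * g3 x y z w) +
    (16%:R / 81%:R * g1 x y z w ^+ 2 + (16%:R / 81%:R * g2 x y z w ^+ 2 +
    (16%:R / 81%:R * g3 x y z w ^+ 2 +
    (32%:R / 81%:R * (g1 x y z w * g2 x y z w) +
    (32%:R / 81%:R * (g1 x y z w * g3 x y z w) +
     32%:R / 81%:R * (g2 x y z w * g3 x y z w))))))))).
  by rewrite /T; field.
(* The square of [D], its cross terms with the pairings, and the square of the pairing part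
   contribute 28672/3, -57344/3 and 28672/3. *)
have sT : sum4 (fun a b c d => T a b c d ^+ 2) = 0.
  rewrite (eq_sum4 _ _ TE) !sum4D !sum4Z.
  by rewrite sD sDg1 sDg2 sDg3 sg1 sg2 sg3 s12 s13 s23; lra.
apply/eqP; rewrite -subr_eq0 -[X in X == 0]/(T a b c d) -sqrf_eq0; apply/eqP.
have sge0 x y z : 0 <= \sum_w T x y z w ^+ 2 by apply: sumr_ge0 => *; apply: sqr_ge0.
have sge1 x y : 0 <= \sum_z \sum_w T x y z w ^+ 2 by apply: sumr_ge0.
have sge2 x : 0 <= \sum_y \sum_z \sum_w T x y z w ^+ 2 by apply: sumr_ge0.
move: sT; rewrite /sum4 => /psumr_eq0P => /(_ (fun x _ => sge2 x) a isT).
move=> /psumr_eq0P => /(_ (fun x _ => sge1 a x) b isT).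
move=> /psumr_eq0P => /(_ (fun x _ => sge0 a b x) c isT).
by move=> /psumr_eq0P => /(_ (fun x _ => sqr_ge0 _) d isT).
Qed.

End EtfFourthMoment.

(** * Degree 4 pseudo-moments and their pseudo-expectation *)

(** Adjacent transpositions generate all permutations of the indices. In [pm_psd], q is the
    coefficient array of a quadratic form, and the condition says that its square has nonnegative
    pseudo-expectation. *)
Record pseudo_moment {R : rcfType} {n : nat}
    (M : 'I_n -> 'I_n -> 'I_n -> 'I_n -> R) : Prop := PseudoMoment {
  pmC12 : forall a b c d, M a b c d = M b a c d;
  pmC23 : forall a b c d, M a b c d = M a c b d;
  pmC34 : forall a b c d, M a b c d = M a b d c;
  pm_sqr : forall a b c d, M a b c c = M a b d d;
  pm_diag : forall a, M a a a a = 1;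
  pm_psd : forall q : 'I_n -> 'I_n -> R,
    0 <= sum4 (fun a b c d => q a b * q c d * M a b c d) }.

Section PseudoExpectation.
Context {R : rcfType} {n : nat}.
Variable M : 'I_n -> 'I_n -> 'I_n -> 'I_n -> R.
Hypothesis pmM : pseudo_moment M.
Implicit Types f g h k : 'I_n -> R.

(* M a b c d stands for E x_a x_b x_c x_d, and f for the linear form
   sum_a f_a x_a.  In [E2] the factor x_c ^ 2 = 1 may use any c; here c = a. *)
Definition E4 f g h k := sum4 (fun a b c d => f a * g b * h c * k d * M a b c d).
Definition E2 f g := \sum_a \sum_b f a * g b * M a b a a.
Definition coord i : 'I_n -> R := fun a => (a == i)%:R.

Lemma E4C12 f g h k : E4 f g h k = E4 g f h k.
Proof.
rewrite /E4 sum4C12; apply: eq_sum4 => a b c d.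
by rewrite (pmC12 _ pmM); ring.
Qed.

Lemma E4C23 f g h k : E4 f g h k = E4 f h g k.
Proof.
rewrite /E4 sum4C23; apply: eq_sum4 => a b c d.
by rewrite (pmC23 _ pmM); ring.
Qed.

Lemma E4C34 f g h k : E4 f g h k = E4 f g k h.
Proof.
rewrite /E4 sum4C34; apply: eq_sum4 => a b c d.
by rewrite (pmC34 _ pmM); ring.
Qed.

Lemma E4_swap f g h k : E4 f g h k = E4 h k f g.
Proof. by rewrite E4C23 E4C12 E4C34 E4C23. Qed.

Lemma E4_sqr_linear x y f g h k :
  E4 (fun a => x * f a + y * g a) (fun a => x * f a + y * g a) h k =
  x ^+ 2 * E4 f f h k + 2 * x * y * E4 f g h k + y ^+ 2 * E4 g g h k.
Proof.
have -> : 2 * x * y * E4 f g h k = x * y * E4 f g h k + x * y * E4 g f h k.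
  by rewrite (E4C12 g); ring.
by rewrite /E4 -!sum4Z -!sum4D; apply: eq_sum4 => a b c d; ring.
Qed.

Lemma E2_sqr_linear x y f g :
  E2 (fun a => x * f a + y * g a) (fun a => x * f a + y * g a) =
  x ^+ 2 * E2 f f + 2 * x * y * E2 f g + y ^+ 2 * E2 g g.
Proof.
have -> : 2 * x * y * E2 f g = x * y * E2 f g + x * y * E2 g f.
  (* [E2] repeats its first index, so its symmetry takes [pm_sqr] as well as [pmC12]. *)
  suff -> : E2 g f = E2 f g by ring.
  rewrite /E2 exchange_big; apply: eq_bigr => a _; apply: eq_bigr => b _ /=.
  by rewrite (pmC12 _ pmM) (pm_sqr _ pmM a b b a); ring.
rewrite /E2 !mulr_sumr -!big_split; apply: eq_bigr => a _ /=.
by rewrite !mulr_sumr -!big_split; apply: eq_bigr => b _ /=; ring.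
Qed.

Lemma sum_coord (F : 'I_n -> R) i : \sum_a coord i a * F a = F i.
Proof.
rewrite (bigD1 i) //= /coord eqxx mul1r big1 ?addr0 // => a /negPf ->.
by rewrite mul0r.
Qed.

Lemma E4_coord f g i j :
  E4 f g (coord i) (coord j) = \sum_a \sum_b f a * g b * M a b i j.
Proof.
apply: eq_bigr => a _; apply: eq_bigr => b _.
transitivity (\sum_c coord i c * (f a * g b * M a b c j)); last exact: sum_coord.
apply: eq_bigr => c _.
transitivity (\sum_d coord j d * (coord i c * (f a * g b * M a b c d))).
  by apply: eq_bigr => d _; ring.
exact: sum_coord.
Qed.

Lemma E4_coord_sqr f g i : E4 f g (coord i) (coord i) = E2 f g.
Proof.
rewrite E4_coord; apply: eq_bigr => a _; apply: eq_bigr => b _.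
by rewrite (pm_sqr _ pmM _ _ i a).
Qed.

Lemma E2_coord i : E2 (coord i) (coord i) = 1.
Proof.
transitivity (\sum_a coord i a * \sum_b coord i b * M a b a a).
  by apply: eq_bigr => a _; rewrite mulr_sumr; apply: eq_bigr => b _; ring.
by rewrite sum_coord sum_coord pm_diag.
Qed.

Lemma E4_sqr_ge0 f g : 0 <= E4 f f g g.
Proof.
rewrite E4C23 /E4; have := pm_psd _ pmM (fun a b => f a * g b).
by congr (_ <= _); apply: eq_sum4 => a b c d; ring.
Qed.

(** Since x_i^2 = x_j^2 = 1, the pseudo-expectation of s^2 (x_i + e x_j)^2 is 2 E s^2 + 2 e E s^2
    x_i x_j; it is nonnegative for e = 1 and e = -1. *)
Lemma E4_coord_norm s i j : `|E4 s s (coord i) (coord j)| <= E2 s s.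
Proof.
have ge0 (e : R) : e ^+ 2 = 1 -> 0 <= 2 * E2 s s + 2 * e * E4 s s (coord i) (coord j).
  move=> e2; have := E4_sqr_ge0 (fun a => 1 * coord i a + e * coord j a) s.
  by rewrite E4_sqr_linear e2 ![E4 _ _ s s]E4_swap !E4_coord_sqr; lra.
have := ge0 1 (expr1n _ _); have := ge0 (-1) (sqrr_sign _ 1).
by rewrite ler_norml; lra.
Qed.

Lemma E4_expand s f g :
  E4 s s f g = \sum_i \sum_j f i * g j * E4 s s (coord i) (coord j).
Proof.
transitivity (sum4 (fun i j a b => s a * s b * f i * g j * M a b i j)).
  (* These four transpositions exchange the pair a, b with the pair c, d. *)
  rewrite sum4C23 sum4C12 sum4C34 sum4C23.
  by apply: eq_sum4 => a b c d.
apply: eq_bigr => i _; apply: eq_bigr => j _.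
rewrite E4_coord mulr_sumr; apply: eq_bigr => a _.
by rewrite mulr_sumr; apply: eq_bigr => b _; ring.
Qed.

(** Expanding f and g in coordinates, each term f_i g_j E s^2 x_i x_j is at most |f_i| |g_j| E
    s^2. *)
Lemma E4_le_l1norm s f g :
  E4 s s f g <= (\sum_i `|f i|) * (\sum_i `|g i|) * E2 s s.
Proof.
rewrite E4_expand mulr_suml mulr_suml; apply: ler_sum => i _.
rewrite -mulrA mulr_suml mulr_sumr; apply: ler_sum => j _.
rewrite mulrA.
apply: le_trans (ler_norm _) _; rewrite !normrM.
by rewrite ler_wpM2l ?mulr_ge0 // E4_coord_norm.
Qed.

(* The gap is the pseudo-expectation of s^2 (100 - u^2) + 8 s^2 (10 - x_i u)
   with s = 4 x_i - u; the weight 8 cancels the terms in x_i u^3. *)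
Lemma E4_quartic_le i (u : 'I_n -> R) : \sum_j `|u j| = 10 ->
  E4 u u u u <= 2880 - 1568 * E2 (coord i) u + 228 * E2 u u.
Proof.
move=> u10; pose s := fun a => 4 * coord i a + (-1) * u a.
have coord1 : \sum_j `|coord i j| = 1.
  rewrite (bigD1 i) //= /coord eqxx normr1 big1 ?addr0 // => a /negPf ->.
  by rewrite normr0.
have := E4_le_l1norm s (coord i) u; have := E4_le_l1norm s u u.
rewrite u10 coord1 E2_sqr_linear !E4_sqr_linear E2_coord.
have -> : E4 (coord i) (coord i) (coord i) u = E2 (coord i) u.
  by rewrite E4_swap E4_coord_sqr.
have -> : E4 (coord i) (coord i) u u = E2 u u by rewrite E4_swap E4_coord_sqr.
have -> : E4 (coord i) u (coord i) u = E2 u u.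
  by rewrite E4C23 E4_swap E4_coord_sqr.
have -> : E4 u u (coord i) u = E4 (coord i) u u u by rewrite E4C23 E4C12.
lra.
Qed.

(** This is E (q - m)^2 >= 0. Only homogeneous forms are available, so the constant m is written m
    x_o^2 for some index o, which exists because n is positive. *)
Lemma variance_ge0 (q : 'I_n -> 'I_n -> R) m : (0 < n)%N ->
  2 * m * (\sum_a \sum_b q a b * M a b a a) - m ^+ 2 <=
  sum4 (fun a b c d => q a b * q c d * M a b c d).
Proof.
move=> n_gt0; pose o := Ordinal n_gt0.
have := pm_psd _ pmM (fun a b => q a b + - m * (coord o a * coord o b)).
have -> : sum4 (fun a b c d => (q a b + - m * (coord o a * coord o b)) *
    (q c d + - m * (coord o c * coord o d)) * M a b c d) =
  sum4 (fun a b c d => q a b * q c d * M a b c d) + (- m * sum4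
   (fun a b c d => q a b * coord o c * coord o d * M a b c d) + (- m *
   sum4 (fun a b c d => coord o a * coord o b * q c d * M a b c d)
  + m ^+ 2 * E4 (coord o) (coord o) (coord o) (coord o))).
  rewrite /E4 -!sum4Z -!sum4D; apply: eq_sum4 => a b c d; ring.
rewrite E4_coord_sqr E2_coord.
have qE : sum4 (fun a b c d => q a b * coord o c * coord o d * M a b c d) =
    \sum_a \sum_b q a b * M a b a a.
  apply: eq_bigr => a _; apply: eq_bigr => b _.
  transitivity (\sum_c coord o c * \sum_d coord o d * (q a b * M a b c d)).
    apply: eq_bigr => c _; rewrite mulr_sumr; apply: eq_bigr => d _; ring.
  by rewrite !sum_coord (pm_sqr _ pmM _ _ o a).
have -> : sum4 (fun a b c d => coord o a * coord o b * q c d * M a b c d) =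
    sum4 (fun a b c d => q a b * coord o c * coord o d * M a b c d).
  rewrite sum4C23 sum4C12 sum4C34 sum4C23; apply: eq_sum4 => a b c d.
  rewrite (pmC23 _ pmM) (pmC12 _ pmM) (pmC34 _ pmM) (pmC23 _ pmM).
  ring.
rewrite qE; lra.
Qed.

End PseudoExpectation.

(** * The bound 112 for pseudo-moments on 28 indices *)

Lemma sum_sym_split {R : comNzRingType} n (h : 'I_n -> 'I_n -> R) :
  (forall i j, h i j = h j i) ->
  \sum_i \sum_j h i j =
  \sum_i h i i + 2 * \sum_(i < n) \sum_(j < n | (i < j)%N) h i j.
Proof.
move=> hC.
have -> : 2 * (\sum_(i < n) \sum_(j < n | (i < j)%N) h i j) =
    \sum_(i < n) \sum_(j < n | (i < j)%N) h i j +
    \sum_(i < n) \sum_(j < n | (j < i)%N) h i j.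
  rewrite (_ : \sum_(i < n) \sum_(j < n | (j < i)%N) h i j =
    \sum_(i < n) \sum_(j < n | (i < j)%N) h i j); first by ring.
  rewrite (exchange_big_dep xpredT) //=.
  by apply: eq_bigr => j _; apply: eq_bigr => i _.
rewrite -!big_split; apply: eq_bigr => i _ /=.
rewrite (bigD1 i) //=; congr (_ + _).
rewrite (bigID (fun j : 'I_n => (i < j)%N)) /=; congr (_ + _).
  by apply: eq_bigl => j; rewrite neq_ltn andb_idl // => ->; rewrite orbT.
by apply: eq_bigl => j; rewrite -leqNgt ltn_neqAle.
Qed.

Lemma ler_sum_affine {R : numDomainType} n (x y z : R) (f g h : 'I_n -> R) :
  (forall i, f i <= x - y * g i + z * h i) ->
  \sum_i f i <= n%:R * x - y * \sum_i g i + z * \sum_i h i.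
Proof.
move=> le_f; apply: le_trans (ler_sum _ (fun i _ => le_f i)) _.
by rewrite !big_split /= sumrN -!mulr_sumr sumr_const card_ord mulr_natl.
Qed.

Lemma ETF_pseudo_moment_le {R : rcfType} (v : 'I_28 -> 'cV[R]_7)
    (M : 'I_28 -> 'I_28 -> 'I_28 -> 'I_28 -> R) :
  is_ETF v -> pseudo_moment M ->
  \sum_(i < 28) \sum_(j < 28 | (i < j)%N) Num.sg (gram v i j) * M i j i i
    <= 112%:R.
Proof.
move=> etf pmM; set Z := gram v.
have Zsym : Z^T = Z by exact: gramC.
have ZC i j : Z i j = Z j i by rewrite -{1}Zsym mxE.
have Zsqr : Z *m Z = 4%:R *: Z.
  by rewrite ETF_gram_sqr //; congr (_ *: _); lra.
have Zrow i : \sum_j `|Z i j| = 10.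
  rewrite (bigD1 i) //= ETF_gram_diag // normr1.
  rewrite (eq_bigr (fun=> 3%:R^-1)); last first.
    by move=> j; rewrite eq_sym => ij; rewrite ETF28_7_gram_norm.
  by rewrite sumr_const cardC1 card_ord /= -mulr_natl; lra.
(* Here [W] and [W2] are the pseudo-expectations of x^T Z x and of its square. *)
pose W := \sum_a \sum_b Z a b * M a b a a.
pose W2 := sum4 (fun a b c d => Z a b * Z c d * M a b c d).
have EW1 : \sum_i E2 M (coord i) (Z i) = W.
  apply: eq_bigr => i _.
  transitivity (\sum_a coord i a * \sum_b Z i b * M a b a a).
    by apply: eq_bigr => a _; rewrite mulr_sumr; apply: eq_bigr => b _; ring.
  exact: sum_coord.
have EW2 : \sum_i E2 M (Z i) (Z i) = 4 * W.
  rewrite exchange_big mulr_sumr; apply: eq_bigr => a _ /=.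
  rewrite exchange_big mulr_sumr; apply: eq_bigr => b _ /=.
  rewrite -mulr_suml mulrA; congr (_ * _).
  rewrite -(tight_gram_row2 Z 4) //; apply: eq_bigr => i _.
  by rewrite (ZC i a) (ZC i b).
have EW4 : \sum_i E4 M (Z i) (Z i) (Z i) (Z i) = 4 / 3 * W2.
  rewrite -sum4_sum.
  (* The three pairings of the 4-design identity all give [W2] by the symmetry of [M], whence three
     times 4/9. *)
  transitivity (4 / 9 * W2 +
     (4 / 9 * sum4 (fun a b c d => Z a c * Z b d * M a b c d) +
      4 / 9 * sum4 (fun a b c d => Z a d * Z b c * M a b c d))).
    rewrite /W2 -!sum4Z -!sum4D; apply: eq_sum4 => a b c d.
    by rewrite -mulr_suml ETF_fourth_moment //; ring.
  have eq2 : sum4 (fun a b c d => Z a c * Z b d * M a b c d) = W2.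
    by rewrite sum4C23; apply: eq_sum4 => a b c d; rewrite (pmC23 _ pmM).
  have -> : sum4 (fun a b c d => Z a d * Z b c * M a b c d) = W2.
    by rewrite -eq2 sum4C34; apply: eq_sum4 => a b c d; rewrite (pmC34 _ pmM).
  by rewrite eq2; lra.
have quartic : 4 / 3 * W2 <= 28 * 2880 - 656 * W.
  have := ler_sum_affine _ _ _ _ _ _ _ (fun i => E4_quartic_le M pmM i _ (Zrow i)).
  by rewrite EW4 EW1 EW2; lra.
(* The centre 100 is close to the positive root, about 101.8, of (4/3) t^2 + 656 t = 80640, so
   little is lost by linearizing the square there. *)
have variance : 2 * 100 * W - 100 ^+ 2 <= W2 by apply: variance_ge0.
set F := (X in X <= _).
(* The two bounds give 2768 W <= 281920, so W < 102, while F = 112 would mean W = 308/3. *)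
suff WF : W = 28 + 2 / 3 * F by move: quartic variance; rewrite WF; lra.
rewrite /W (sum_sym_split _ (fun i j => Z i j * M i j i i)); last first.
  by move=> i j; rewrite ZC (pmC12 _ pmM) (pm_sqr _ pmM _ _ i j).
congr (_ + _).
  transitivity (\sum_(i < 28) (1 : R)); last by rewrite sumr_const card_ord.
  by apply: eq_bigr => i _; rewrite ETF_gram_diag // pm_diag // mulr1.
rewrite -mulrA; congr (_ * _); rewrite mulr_sumr; apply: eq_bigr => i _.
rewrite mulr_sumr; apply: eq_bigr => j ij.
rewrite {1}[Z i j]numEsg ETF28_7_gram_norm //; first by ring.
by apply: contraTneq ij => ->; rewrite ltnn.
Qed.

(** * From pseudomoment matrices to pseudo-moments *)

Lemma pseudomoment4_restrict {R : rcfType} n N (Y : 'M[R]_(N * N))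
    (pi : 'I_n -> 'I_N) : is_pseudomoment4 Y ->
  pseudo_moment (fun a b c d => Yent Y (pi a) (pi b) (pi c) (pi d)).
Proof.
move=> [psdY [sqrY [diagY symY]]].
have YC (x y z w : 'I_N) (s : {perm 'I_4})
    (f := fun o : 'I_4 => nth x [:: x; y; z; w] o) :
  Yent Y (f (s 0)) (f (s 1)) (f (s 2)) (f (s 3)) = Yent Y x y z w.
  by rewrite symY.
split.
- move=> a b c d.
  by rewrite -(YC (pi b) _ _ _ (tperm 0 1)) tpermL tpermR !tpermD.
- move=> a b c d.
  by rewrite -(YC (pi a) (pi c) _ _ (tperm 1 2)) tpermL tpermR !tpermD.
- move=> a b c d.
  by rewrite -(YC (pi a) (pi b) (pi d) _ (tperm 2 3)) tpermL tpermR !tpermD.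
- by move=> a b c d; apply: sqrY.
- by move=> a; apply: diagY.
move=> q.
(* The form q is carried along [pi] to a vector x on pairs, and x^T Y x is the sum required by
   [pm_psd]. *)
pose e a b : 'cV[R]_(N * N) := delta_mx (mxvec_index (pi a) (pi b)) 0.
pose x := \sum_a \sum_b q a b *: e a b.
have xY i : (x^T *m Y) 0 i =
    \sum_a \sum_b q a b * Y (mxvec_index (pi a) (pi b)) i.
  rewrite linear_sum mulmx_suml summxE; apply: eq_bigr => a _.
  rewrite linear_sum mulmx_suml summxE; apply: eq_bigr => b _.
  by rewrite linearZ /= trmx_delta -scalemxAl -rowE !mxE.
have := psdY x; congr (_ <= _).
rewrite sum4C23 sum4C12 sum4C34 sum4C23.
rewrite {2}/x mulmx_sumr summxE; apply: eq_bigr => c _.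
rewrite mulmx_sumr summxE; apply: eq_bigr => d _.
rewrite -scalemxAr -colE mxE mxE xY mulr_sumr; apply: eq_bigr => a _.
by rewrite mulr_sumr; apply: eq_bigr => b _; rewrite /Yent; ring.
Qed.

(** Permuting indices turns Y_(1i)(1j) into Y_(ij)(11), and the repeated index 1 may then be
    replaced by i. *)
Lemma extends_entry {R : rcfType} N (X : 'M[R]_N) (Y : 'M[R]_(N * N)) (i j : 'I_N) :
  is_pseudomoment4 Y -> extends Y X -> X i j = Yent Y i j i i.
Proof.
move=> pmY extY; have N_gt0 : (0 < N)%N := leq_ltn_trans (leq0n i) (ltn_ord i).
have pmM := pseudomoment4_restrict N N Y id pmY.
rewrite -(extY (Ordinal N_gt0)) //.
by rewrite (pmC12 _ pmM) (pmC34 _ pmM) (pmC23 _ pmM) (pm_sqr _ pmM _ _ _ i).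
Qed.

(** * Independence from the triangle inequalities *)

Lemma tri_lhs_le1 {R : rcfType} N (X : 'M[R]_N) s i j k :
  (forall a b, `|X a b| <= 3%:R^-1) -> tri_lhs s i j k X <= 1.
Proof.
move=> X3.
have le3 (b c : bool) (x y : 'I_N) : - (sgnb R b * sgnb R c * X x y) <= 3%:R^-1.
  apply: le_trans (ler_norm _) _; rewrite normrN !normrM.
  by case: b; case: c; rewrite /sgnb ?normrN !normr1 !mul1r.
have := le3 (s i) (s j) i j; have := le3 (s j) (s k) j k.
by have := le3 (s i) (s k) i k; rewrite /tri_lhs; lra.
Qed.

(** Weak duality: a symmetric X satisfying all triangle inequalities satisfies every nonnegative
    combination of them. *)
Lemma triangle_derivable_le {R : rcfType} N (c : 'M[R]_N -> R) b X :
  triangle_derivable c b -> X^T = X ->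
  (forall s i j k, tri_lhs s i j k X <= 1) -> c X <= b.
Proof.
move=> [lam [lam_ge0 [lamE lam_le]]] Xsym triX.
rewrite -lamE //; apply: le_trans lam_le.
do 4![apply: ler_sum => ? _].
by rewrite -[leRHS]mulr1 ler_wpM2l.
Qed.

(** The witness is sgn(Z) / 3 carried along [pi], with value 378/3 = 126. Its diagonal is not set to
    1, so one entrywise bound of 1/3 covers everything. *)
Lemma ETF_form_gt112 {R : rcfType} (v : 'I_28 -> 'cV[R]_7) N
    (pi : 'I_28 -> 'I_N) : is_ETF v -> injective pi ->
  exists X : 'M[R]_N, [/\ X^T = X, forall a b, `|X a b| <= 3%:R^-1 &
    112%:R < etf_form (gram v) pi X].
Proof.
move=> etf pi_inj; set Z := gram v.
have ZC i j : Z i j = Z j i by rewrite /Z -{1}(gramC _ _ v) mxE.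
(* [pick] inverts [pi] on its image; entries outside the image are 0. *)
pose X : 'M[R]_N := \matrix_(a, b)
  if [pick i | pi i == a] is Some i then
    if [pick j | pi j == b] is Some j then 3%:R^-1 * Num.sg (Z i j) else 0
  else 0.
have XE i j : X (pi i) (pi j) = 3%:R^-1 * Num.sg (Z i j).
  rewrite mxE; case: pickP => [i' /eqP/pi_inj -> | /(_ i)]; last by rewrite eqxx.
  by case: pickP => [j' /eqP/pi_inj -> | /(_ j)]; last by rewrite eqxx.
exists X; split.
- apply/matrixP => a b; rewrite !mxE.
  by case: pickP => [i _|_]; case: pickP => // j _; rewrite ZC.
- move=> a b; rewrite mxE.
  case: pickP => [i _|_]; last by rewrite normr0 invr_ge0 ler0n.
  case: pickP => [j _|_]; last by rewrite normr0 invr_ge0 ler0n.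
  rewrite normrM normr_sg ger0_norm ?invr_ge0 ?ler0n //.
  by rewrite ler_piMr ?invr_ge0 ?ler0n // lern1 leq_b1.
rewrite /etf_form.
suff -> : \sum_(i < 28) \sum_(j < 28 | (i < j)%N)
    Num.sg (Z i j) * X (pi i) (pi j) = 126%:R by rewrite ltr_nat.
transitivity (\sum_(i < 28) \sum_(j < 28 | (i < j)%N) (3%:R^-1 : R)).
  apply: eq_bigr => i _; apply: eq_bigr => j ij.
  rewrite XE mulrCA -expr2 sqr_sg.
  suff -> : Z i j != 0 by rewrite mulr1.
  rewrite -normr_eq0 ETF28_7_gram_norm ?invr_eq0 ?pnatr_eq0 //.
  by apply: contraTneq ij => ->; rewrite ltnn.
(* The constant function counts the pairs i < j: 28^2 / 3 = 28/3 + 2 S. *)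
have := sum_sym_split 28 (fun _ _ => 3%:R^-1 : R) (fun _ _ => erefl).
set S := (X in X = 126%:R).
have sum28 (x : R) : \sum_(i < 28) x = 28 * x.
  by rewrite sumr_const card_ord mulr_natl.
by rewrite !sum28 -/S; lra.
Qed.

Theorem theorem5 (R : rcfType) (v : 'I_28 -> 'cV[R]_7) (N : nat) :
  is_ETF v -> (28 <= N)%N ->
  (forall (X : 'M[R]_N) (pi : 'I_28 -> 'I_N),
     in_E4 X -> injective pi -> etf_form (gram v) pi X <= 112%:R) /\
  (forall pi : 'I_28 -> 'I_N, injective pi ->
     ~ triangle_derivable (etf_form (gram v) pi) 112%:R).
Proof.
move=> etf _; split=> [X pi [_ [Y [pmY extY]]] _ | pi pi_inj der].
  have := ETF_pseudo_moment_le v _ etf (pseudomoment4_restrict 28 N Y pi pmY).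
  congr (_ <= _); apply: eq_bigr => i _; apply: eq_bigr => j _.
  by rewrite (extends_entry N X Y).
have [X [Xsym X3]] := ETF_form_gt112 v N pi etf pi_inj.
by rewrite ltNge (triangle_derivable_le _ _ _ _ der Xsym) // => *; apply: tri_lhs_le1.
Qed.
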